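(* For every graph $G$ on $n$ vertices and every integer $\ell\ge 1$, the integrality gap of $\mathrm{SA}^+_\ell(G)$ is at least $\frac{n}{\alpha(G)\,(\omega(G)+\ell)}$.
   Context: Let $G=(V,E)$ with $V=[n]$. $\mathrm{SA}^+_\ell(G)$ (the level-$\ell$ Sherali--Adams strengthening of the clique-constrained stable set relaxation QSTAB) is the linear program in variables $y_A$, $A\subseteq[n]$: maximize $\sum_{i\in[n]} y_{\{i\}}$ subject to $y_\emptyset=1$ and, for all $S,T\subseteq[n]$ with $S\cap T=\emptyset$ and $|S\cup T|\le\ell$: (i) for every clique $Q$ of $G$, $\sum_{T'\subseteq T}(-1)^{|T'|}y_{S\cup T'}-\sum_{i\in Q}\sum_{T'\subseteq T}(-1)^{|T'|}y_{S\cup T'\cup\{i\}}\ge 0$; (ii) $\sum_{T'\subseteq T}(-1)^{|T'|}y_{S\cup T'}\ge 0$; (iii) for every $i\in[n]$, $\sum_{T'\subseteq T}(-1)^{|T'|}y_{S\cup T'\cup\{i\}}\ge 0$. The integrality gap of $\mathrm{SA}^+_\ell(G)$ is its optimum value divided by $\alpha(G)$, the maximum size of an independent set of $G$. $\omega(G)$ is the clique number. *)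

(* Defs.v *)
(* classical_sets comes first so that [set0] etc. are those of finset. *)
From mathcomp Require Import classical_sets reals.
From mathcomp Require Import all_boot all_order all_algebra.

Set Implicit Arguments.
Unset Strict Implicit.
Unset Printing Implicit Defensive.

Import Order.TTheory GRing.Theory Num.Theory.
Local Open Scope ring_scope.

(* A simple graph on [n] is given by its adjacency relation [G : rel 'I_n],
   assumed symmetric and irreflexive where it is used. *)
Definition clique (n : nat) (G : rel 'I_n) (Q : {set 'I_n}) : bool :=
  [forall i in Q, forall j in Q, (i != j) ==> G i j].

Definition independent (n : nat) (G : rel 'I_n) (A : {set 'I_n}) : bool :=
  [forall i in A, forall j in A, ~~ G i j].

Definition clique_number (n : nat) (G : rel 'I_n) : nat :=
  (\max_(Q : {set 'I_n} | clique G Q) #|Q|)%N.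

Definition independence_number (n : nat) (G : rel 'I_n) : nat :=
  (\max_(A : {set 'I_n} | independent G A) #|A|)%N.

Record SA_feasible (R : realType) (n : nat) (G : rel 'I_n) (l : nat)
    (y : {set 'I_n} -> R) : Prop := {
  SA_empty : y set0 = 1;
  SA_clique : forall S T : {set 'I_n},
    S :&: T = set0 -> (#|S :|: T| <= l)%N ->
    forall Q : {set 'I_n}, clique G Q ->
      0 <= \sum_(T' : {set 'I_n} | T' \subset T)
             (-1) ^+ #|T'| * y (S :|: T')
         - \sum_(i in Q) \sum_(T' : {set 'I_n} | T' \subset T)
             (-1) ^+ #|T'| * y (S :|: T' :|: [set i]);
  SA_nonneg : forall S T : {set 'I_n},
    S :&: T = set0 -> (#|S :|: T| <= l)%N ->
      0 <= \sum_(T' : {set 'I_n} | T' \subset T)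
             (-1) ^+ #|T'| * y (S :|: T');
  SA_nonneg_vertex : forall S T : {set 'I_n},
    S :&: T = set0 -> (#|S :|: T| <= l)%N ->
    forall i : 'I_n,
      0 <= \sum_(T' : {set 'I_n} | T' \subset T)
             (-1) ^+ #|T'| * y (S :|: T' :|: [set i])
}.

Definition SA_objective (R : realType) (n : nat) (y : {set 'I_n} -> R) : R :=
  \sum_(i < n) y [set i].

(* The program is feasible, and bounded since the clique [set i] with
   S = T = set0 gives y [set i] <= 1; so this [sup] is a genuine supremum. *)
Definition SA_optimum (R : realType) (n : nat) (G : rel 'I_n) (l : nat) : R :=
  sup (@SA_objective R n @` [set y | SA_feasible G l y])%classic.

Definition SA_integrality_gap (R : realType) (n : nat) (G : rel 'I_n)
    (l : nat) : R :=
  SA_optimum R G l / (independence_number G)%:R.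

(* Main.v *)
(* The point y with y_0 = 1, y_{i} = c := 1 / (omega(G) + l) and y_A = 0 for
   |A| >= 2 is feasible and has objective value n c.  For S nonempty only
   T' = 0 contributes to the alternating sums; for S = 0 the clique constraint
   reads 1 - |T| c - |Q \ T| c >= 0, which holds since |T| <= l and
   |Q| <= omega(G). *)
Require Import Defs.
From mathcomp Require Import classical_sets reals.
From mathcomp Require Import all_boot all_order all_algebra.

Import Order.TTheory GRing.Theory Num.Theory.
Local Open Scope ring_scope.

Lemma sum_subset_card_le1 (V : nmodType) (I : finType) (T : {set I})
    (F : {set I} -> V) :
  (forall A : {set I}, (1 < #|A|)%N -> F A = 0) ->
  \sum_(A : {set I} | A \subset T) F A = F set0 + \sum_(j in T) F [set j].
Proof.
move=> F0; rewrite (bigD1 set0) ?sub0set //=; congr (_ + _).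
rewrite -(big_imset F (h := fun j => [set j])) /=; last first.
  by move=> i j _ _; apply: set1_inj.
rewrite (bigID (fun A : {set I} => #|A| == 1)%N) /= [X in _ + X]big1 ?addr0.
  apply: eq_bigl => A; apply/idP/imsetP => [/andP[/andP[AT _] /cards1P[j Aj]]|].
    by exists j; rewrite // -sub1set -Aj.
  by move=> [j jT ->]; rewrite sub1set jT cards1 -card_gt0 cards1.
move=> A /andP[/andP[_ A0] A1]; apply: F0.
by rewrite ltn_neqAle eq_sym A1 card_gt0.
Qed.

Section SingletonPoint.
Variables (R : realType) (n : nat) (c : R).
Implicit Types S T U A Q : {set 'I_n}.

Definition singleton_point A : R :=
  if A == set0 then 1 else if #|A| == 1%N then c else 0.

Local Notation y := singleton_point.

Lemma singleton_point0 : y set0 = 1.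
Proof. by rewrite /y eqxx. Qed.

Lemma singleton_point1 i : y [set i] = c.
Proof. by rewrite /y -cards_eq0 cards1 eqxx. Qed.

Lemma singleton_point_gt1 A : (1 < #|A|)%N -> y A = 0.
Proof. by rewrite /y -cards_eq0; case: #|A| => [|[|]]. Qed.

Lemma singleton_point_ge0 A : 0 <= c -> 0 <= y A.
Proof. by move=> c0; rewrite /y; do 2?case: ifP. Qed.

(** A set [T'] with at least two elements makes its argument that large too, so only the empty set
    and the singletons inside [T] survive. The parameter [U] lets one expansion serve the plain sums
    (empty [U]) and the vertex sums ([U = [set i]]). *)
Lemma singleton_point_alt_sum S T U :
  \sum_(T' : {set 'I_n} | T' \subset T) (-1) ^+ #|T'| * y (S :|: T' :|: U)
    = y (S :|: U) - \sum_(j in T) y (S :|: [set j] :|: U).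
Proof.
rewrite sum_subset_card_le1 => [|A A1].
  rewrite cards0 expr0 mul1r setU0; congr (_ + _); rewrite -sumrN.
  by apply: eq_bigr => j _; rewrite cards1 expr1 mulN1r.
rewrite singleton_point_gt1 ?mulr0 // (leq_trans A1) // subset_leq_card //.
by rewrite setUAC subsetUr.
Qed.

Lemma singleton_point_alt_sum_base S T : S :&: T = set0 ->
  \sum_(T' : {set 'I_n} | T' \subset T) (-1) ^+ #|T'| * y (S :|: T')
    = if S == set0 then 1 - #|T|%:R * c else y S.
Proof.
move=> ST0; under eq_bigr => A _ do rewrite -[S :|: A]setU0.
rewrite singleton_point_alt_sum setU0.
case: eqP => [->|/eqP S0].
  rewrite singleton_point0; under eq_bigr => j _ do
    rewrite setU0 set0U singleton_point1.
  by rewrite sumr_const mulr_natl.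
(* For nonempty [S], disjointness from [T] forces [S] with [j] added to have at least two
   elements. *)
rewrite big1 ?subr0 // => j jT; rewrite setU0 singleton_point_gt1 // setUC.
have jS : j \notin S.
  by apply/negP => jS; have := in_set0 j; rewrite -ST0 inE jS jT.
by rewrite cardsU1 jS ltnS card_gt0.
Qed.

(** If [i] lies in [T], the sets [T'] equal to [set0] and [[set i]] give the same argument with
    opposite signs and cancel. Otherwise only the leading term can be nonzero. *)
Lemma singleton_point_alt_sum_vertex S T i : S :&: T = set0 ->
  \sum_(T' : {set 'I_n} | T' \subset T)
      (-1) ^+ #|T'| * y (S :|: T' :|: [set i])
    = if (S \subset [set i]) && (i \notin T) then c else 0.
Proof.
move=> ST0; rewrite singleton_point_alt_sum.
(* The union contains [i]: either it equals [[set i]], or it contains it properly and has more than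
   one element. *)
have yi j : y (S :|: [set j] :|: [set i])
    = if (S \subset [set i]) && (j == i) then c else 0.
  case: ifP => [/andP[/setUidPr Si /eqP ->]|Sji].
    by rewrite -setUA setUid Si singleton_point1.
  apply: singleton_point_gt1; rewrite -(cards1 i); apply: proper_card.
  by rewrite properE subsetUr !subUset subxx andbT sub1set inE Sji.
have -> : y (S :|: [set i]) = if S \subset [set i] then c else 0.
  by have := yi i; rewrite -setUA setUid eqxx andbT.
under eq_bigr do rewrite yi.
case: (S \subset [set i]) => /=; last by rewrite big1 ?subr0.
rewrite -big_mkcondr /=; have [iT|iT] := boolP (i \in T).
  rewrite (big_pred1 i) ?subrr // => j.
  by rewrite /=; case: eqP => [->|_]; rewrite ?iT ?andbF.
rewrite big_pred0 ?subr0 // => j.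
by case: eqP => [->|_]; rewrite ?andbF // (negbTE iT).
Qed.

Lemma singleton_point_feasible (G : rel 'I_n) (l : nat) :
  0 <= c -> ((clique_number G)%:R + l%:R) * c <= 1 ->
  SA_feasible G l y.
Proof.
move=> c0 c1.
(* Used for [S] empty: [k] is the number of vertices of [Q] outside [T] in the clique constraint,
   and 0 in the plain nonnegativity constraint. *)
have Tc T k : (#|T| + k <= clique_number G + l)%N ->
    0 <= 1 - #|T|%:R * c - k%:R * c.
  move=> Tk; rewrite -addrA -opprD -mulrDl subr_ge0 (le_trans _ c1) //.
  by rewrite ler_wpM2r // -!natrD ler_nat.
split.
- exact: singleton_point0.
- move=> S T ST0 STl Q cQ; rewrite singleton_point_alt_sum_base //.
  under eq_bigr do rewrite singleton_point_alt_sum_vertex //.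
  rewrite -big_mkcondr /=; case: eqP STl => [-> | /eqP S0 _].
    rewrite set0U => Tl; rewrite sumr_const -[c *+ _]mulr_natl; apply: Tc.
    rewrite addnC leq_add //.
    apply: leq_trans (leq_bigmax_cond (P := clique G) (F := fun A => #|A|) _ cQ).
    by apply: subset_leq_card; apply/fintype.subsetP => i /andP[].
  (* When [S] is a singleton [[set s]], only [i = s] can contribute, so at most one [c] is
     subtracted from [c]. When [S] is larger, no [[set i]] contains it and nothing is subtracted. *)
  rewrite subr_ge0; have [S1|S1] := eqVneq #|S| 1%N.
    have /eqP/cards1P[s Ss] := S1; rewrite Ss singleton_point1.
    rewrite (eq_bigl (fun i => (i == s) && ((s \in Q) && (s \notin T)))); last first.
      move=> i; rewrite sub1set inE eq_sym.
      by case: eqP => [->|_] //=; rewrite andbF.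
    case: (_ && _); last by rewrite big_pred0 // => i; rewrite andbF.
    by rewrite (big_pred1 s) // => i; rewrite andbT.
  rewrite big_pred0 ?singleton_point_ge0 // => i.
  rewrite subset1 (negbTE S0) orbF; case: eqP => [Si|]; last by rewrite andbF.
  by rewrite Si cards1 eqxx in S1.
- move=> S T ST0 STl; rewrite singleton_point_alt_sum_base //.
  case: eqP STl => [-> | _ _]; last exact: singleton_point_ge0.
  rewrite set0U => Tl; have := Tc T 0%N; rewrite mul0r subr0; apply.
  by rewrite addn0 (leq_trans Tl) ?leq_addl.
- move=> S T ST0 _ i; rewrite singleton_point_alt_sum_vertex //.
  by case: ifP.
Qed.

Lemma singleton_point_objective : SA_objective y = n%:R * c.
Proof.
rewrite /SA_objective; under eq_bigr do rewrite singleton_point1.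
by rewrite sumr_const card_ord mulr_natl.
Qed.

End SingletonPoint.

(** This supplies the upper bound without which a feasible value could not be compared with
    [sup]. *)
Lemma SA_objective_le (R : realType) (n : nat) (G : rel 'I_n) (l : nat)
    (y : {set 'I_n} -> R) :
  SA_feasible G l y -> SA_objective y <= n%:R.
Proof.
move=> [y0 yQ _ _]; rewrite /SA_objective -[X in _ <= X%:R]card_ord -sumr_const.
apply: ler_sum => i _.
have cli : clique G [set i].
  apply/'forall_implyP => j /set1P ->; apply/'forall_implyP => k /set1P ->.
  by rewrite eqxx.
have := yQ set0 set0 (set0I _) _ _ cli; rewrite setU0 cards0 => /(_ isT).
rewrite big_set1 !(big_pred1 set0); try by move=> A; rewrite subset0.
by rewrite cards0 expr0 !mul1r !set0U y0 subr_ge0.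
Qed.

Theorem theorem7 (R : realType) (n : nat) (G : rel 'I_n)
    (G_sym : symmetric G) (G_irr : irreflexive G) (l : nat) (l_ge1 : (1 <= l)%N) :
  n%:R / ((independence_number G)%:R * ((clique_number G)%:R + l%:R))
    <= SA_integrality_gap R G l.
Proof.
have wl_gt0 : 0 < (clique_number G)%:R + l%:R :> R.
  by rewrite -natrD ltr0n addn_gt0 l_ge1 orbT.
(* Only nonnegativity of the inverse of the independence number is needed, so the case [n = 0],
   where that number is 0 and its inverse is 0 by convention, is covered. *)
rewrite /SA_integrality_gap invfM mulrCA mulrC ler_wpM2r ?invr_ge0 ?ler0n //.
rewrite -singleton_point_objective /SA_optimum; apply: ub_le_sup.
  by exists n%:R => _ [y yG <-]; apply: SA_objective_le yG.
(* Unification takes the witness from the goal: the singleton point whose [c] is the inverse of the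
   clique number plus [l]. *)
eexists; last reflexivity.
apply: singleton_point_feasible; first by rewrite invr_ge0 ltW.
by rewrite mulfV // gt_eqF.
Qed.
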